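(* For every constant $\varepsilon_0>0$ there is a constant $c>0$ such that for all $k\ge 2$, all $\varepsilon\in(0,\varepsilon_0]$ and all $\alpha\in(0,1/2]$, any $\varepsilon$-pan-private uniformity tester over domain $[k]$ with distance parameter $\alpha$ requires $m\ge c\left(\frac{k^{2/3}}{\alpha^{4/3}\varepsilon^{2/3}}+\frac{\sqrt{k}}{\alpha^2}+\frac{1}{\alpha\varepsilon}\right)$ samples.
   Context: Uniformity testing: given $m$ i.i.d. samples from an unknown distribution $p$ on $[k]$, an algorithm is a uniformity tester on $m$ samples with distance parameter $\alpha$ if when $p=U_k$ (uniform on $[k]$) it outputs ''uniform'' with probability $\ge 2/3$, and when $d_{TV}(p,U_k)\ge\alpha$ it outputs ''non-uniform'' with probability $\ge 2/3$. Pan-privacy: the samples are processed as a stream by an algorithm with a randomized internal update map $\mathcal{A}_{\mathcal{I}}\colon\mathcal{I}\times[k]\to\mathcal{I}$ applied once per element, and an output algorithm $\mathcal{A}_{\mathcal{O}}$ applied to the final internal state. Two streams are neighbors if one is obtained from the other by replacing a single element. The algorithm is $\varepsilon$-pan-private if for all neighboring streams $s,s'$, every time $t$, and every set $E\subset\mathcal{I}\times\mathcal{O}$, $\Pr[(\mathcal{A}_{\mathcal{I}}(s_{\le t}),\mathcal{A}_{\mathcal{O}}(\mathcal{A}_{\mathcal{I}}(s)))\in E]\le e^{\varepsilon}\Pr[(\mathcal{A}_{\mathcal{I}}(s'_{\le t}),\mathcal{A}_{\mathcal{O}}(\mathcal{A}_{\mathcal{I}}(s')))\in E]$, where $\mathcal{A}_{\mathcal{I}}(s_{\le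 t})$ denotes the internal state after the first $t$ elements. *)

(* Defs.v *)
From HB Require Import structures.
From mathcomp Require Import all_boot all_order all_algebra.
From mathcomp Require Import all_classical all_reals all_analysis.
Set Implicit Arguments.
Unset Strict Implicit.
Unset Printing Implicit Defensive.
Import Order.TTheory GRing.Theory Num.Theory.
Local Open Scope classical_set_scope.
Local Open Scope ring_scope.

(* The domain [k] is 'I_k. *)

Definition is_distribution (R : realType) (k : nat) (p : 'I_k -> R) : Prop :=
  (forall x, 0 <= p x) /\ \sum_(x < k) p x = 1.

Definition uniform_dist (R : realType) (k : nat) : 'I_k -> R :=
  fun=> k%:R^-1.

Definition dTV (R : realType) (k : nat) (p q : 'I_k -> R) : R :=
  2^-1 * \sum_(x < k) `|p x - q x|.

(* A randomized map I * [k] -> I is a Markov kernel on I for each letter of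
   [k]; since [k] is finite and discrete, joint measurability is automatic.
   The initial state may be random. *)
Record stream_algorithm (R : realType) (k : nat)
    (dI : measure_display) (I : measurableType dI)
    (dO : measure_display) (O : measurableType dO) := StreamAlgorithm {
  initial : probability I R ;
  update : 'I_k -> R.-pker I ~> I ;
  output : R.-pker I ~> O }.

Section StreamAlgorithms.
Context (R : realType) (k : nat).
Context (dI : measure_display) (I : measurableType dI).
Context (dO : measure_display) (O : measurableType dO).
Variable A : stream_algorithm R k I O.

(* E[f(X)], for X the internal state reached from state i after reading s. *)
Fixpoint expect_from (s : seq 'I_k) (f : I -> \bar R) (i : I) : \bar R :=
  if s is x :: s' then (\int[update A x i]_j expect_from s' f j)%E else f i.

(* Pr[A_O(A_I(s)) \in F] *)
Definition output_prob (s : seq 'I_k) (F : set O) : \bar R :=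
  (\int[initial A]_i expect_from s (fun j => output A j F) i)%E.

(* Pr[(A_I(s_{<=t}), A_O(A_I(s))) \in E]: conditionally on the state i after
   the first t elements, the run resumes from i on the rest of the stream. *)
Definition joint_prob (s : seq 'I_k) (t : nat) (E : set (I * O)) : \bar R :=
  (\int[initial A]_i0
     expect_from (take t s)
       (fun i => expect_from (drop t s)
                   (fun j => output A j (xsection E i)) i)
       i0)%E.

End StreamAlgorithms.

Definition neighbors (T : Type) (s s' : seq T) : Prop :=
  exists (s1 : seq T) (x x' : T) (s2 : seq T),
    s = s1 ++ x :: s2 /\ s' = s1 ++ x' :: s2.

Definition pan_private (R : realType) (k : nat)
    (dI : measure_display) (I : measurableType dI)
    (dO : measure_display) (O : measurableType dO)
    (eps : R) (A : stream_algorithm R k I O) : Prop :=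
  forall (s s' : seq 'I_k), neighbors s s' ->
  forall t : nat, (0 < t <= size s)%N ->
  forall E : set (I * O), measurable E ->
    (joint_prob A s t E <= (expR eps)%:E * joint_prob A s' t E)%E.

(* Pr[A outputs b] when A reads m i.i.d. samples from p. *)
Definition iid_output_prob (R : realType) (k : nat)
    (dI : measure_display) (I : measurableType dI)
    (A : stream_algorithm R k I bool) (p : 'I_k -> R) (m : nat) (b : bool)
    : \bar R :=
  (\sum_(s : m.-tuple 'I_k)
     (\prod_(j < m) p (tnth s j))%R%:E * output_prob A s [set b])%E.

(* The output true stands for "uniform", false for "non-uniform". *)
Definition uniformity_tester (R : realType) (k : nat)
    (dI : measure_display) (I : measurableType dI)
    (m : nat) (alpha : R) (A : stream_algorithm R k I bool) : Prop :=
  ((2 / 3)%:E <= iid_output_prob A (@uniform_dist R k) m true)%E /\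
  forall p : 'I_k -> R, is_distribution p ->
    alpha <= dTV p (@uniform_dist R k) ->
    ((2 / 3)%:E <= iid_output_prob A p m false)%E.

(* Main.v *)
(** Partition [k] into blocks of two letters (three for one block if k is odd)
and, independently in each block, move mass so that the resulting random
distribution p_theta is at distance alpha from uniform. A tester separates the
null from every p_theta, hence from their mixture.

The chi-square divergence of the mixture over m samples is
E (1 + <phi_theta, phi_theta'>)^m - 1 <= exp(O(m^2 alpha^4 / k)) - 1, which gives
sqrt k / alpha^2. Replacing samples of the null by samples of a single p_theta
one at a time changes the output law by a factor exp(O(m alpha eps)), which
gives 1 / (alpha eps).

For the main term, the law of the state at time t + 1 under the mixture is
obtained from its law at time t by feeding a letter drawn from the posterior mean
of p_theta given the state. Privacy of the state at time t makes it nearly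
independent of the choice in any one block (a block carries mass O(1 / k)): the
posterior mean deviates from uniform by a relative O(alpha^2 t eps / k). Since
the deviations are centered, this costs a factor 1 + O(alpha^2 t eps / k)^2 in
second moment, and the sum over t <= m is O(alpha^4 eps^2 m^3 / k^2). *)
Require Import Defs.
From HB Require Import structures.
From mathcomp Require Import all_boot all_order all_algebra.
From mathcomp Require Import all_classical all_reals all_analysis.
From mathcomp Require Import measurable_realfun ring lra zify.
Set Implicit Arguments.
Unset Strict Implicit.
Unset Printing Implicit Defensive.
Import Order.TTheory GRing.Theory Num.Theory.
Local Open Scope classical_set_scope.
Local Open Scope ring_scope.

(** * Elementary inequalities and expectations over i.i.d. sequences *)

Section Elementary.
Context (R : realType).
Implicit Types (x u z eta : R).

Lemma expR_sub1_le x : expR x - 1 <= x * expR x.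
Proof.
have := expR_ge1Dx (- x); have := expR_gt0 x.
move=> e0 /(ler_wpM2r (ltW e0)); rewrite -expRD addNr expR0; nra.
Qed.

(** The bound [ln z >= 1 - z^-1] without the logarithm: it turns a constant-factor gap between null
    and alternative into a constant lower bound on an exponent. *)
Lemma expR_lower u z : 0 < z -> z <= expR u -> 1 - z^-1 <= u.
Proof.
move=> z0 zu; have := expR_ge1Dx (- u).
rewrite expRN => h; have : (expR u)^-1 <= z^-1 by rewrite lef_pV2 ?posrE ?expR_gt0.
lra.
Qed.

(** A sub-Gaussian estimate: the linear term vanishes once averaged over a centered [z]. For
    [z > 1 / 3] the exponent [3 * z ^+ 2] already exceeds [z]; for [z <= - (1 / 3)] the left side is
    at most 1 and [z + 3 * z ^+ 2] is nonnegative. *)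
Lemma expR_le_sqr z : expR z <= z + expR (3 * z ^+ 2).
Proof.
have h3 := expR_ge1Dx (3 * z ^+ 2).
have [z1|z1] := lerP z (1 / 3); last first.
  have : expR z <= expR (3 * z ^+ 2) by rewrite ler_expR; nra.
  lra.
have [z2|z2] := lerP z (- (1 / 3)).
  have : expR z <= 1 by rewrite -expR0 ler_expR; lra.
  nra.
(* In the middle range, [(1 - z / 2) ^+ 2] is a lower bound for [expR (- z)]; multiplying by it
   leaves the polynomial inequality [h5]. *)
suff: expR z <= 1 + z + z ^+ 2 by nra.
have := expR_ge1Dx (- (z / 2)) => h.
have e0 := expR_gt0 z.
have h2 : (1 - z / 2) ^+ 2 <= expR (- z).
  have -> : expR (- z) = expR (- (z / 2)) ^+ 2.
    by rewrite expr2 -expRD; congr expR; field.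
  by rewrite lerXn2r ?nnegrE ?expR_ge0 //; lra.
have h4 : (1 - z / 2) ^+ 2 * expR z <= 1.
  by move: h2 => /(ler_wpM2r (ltW e0)); rewrite -expRD addNr expR0.
have h5 : 1 <= (1 - z / 2) ^+ 2 * (1 + z + z ^+ 2).
  have -> : (1 - z / 2) ^+ 2 * (1 + z + z ^+ 2)
    = 1 + z ^+ 2 / 4 * (1 - 3 * z + z ^+ 2) by field.
  have : 0 <= 1 - 3 * z + z ^+ 2 by nra.
  have : 0 <= z ^+ 2 by exact: sqr_ge0.
  nra.
have h6 : 0 < (1 - z / 2) ^+ 2 by rewrite exprn_gt0 //; lra.
by rewrite -(ler_pM2l h6); lra.
Qed.

Lemma le_expR_mulrn (x : R) (n : nat) : 0 <= 1 + x -> (1 + x) ^+ n <= expR (n%:R * x).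
Proof.
move=> x0; rewrite expRM_natl; apply: lerXn2r => //.
  by rewrite nnegrE expR_ge0.
exact: expR_ge1Dx.
Qed.

(** The sum is the smaller of [N] and the integer part of [y]. With the next lemma, it rounds a
    function down to a combination of indicators of superlevel sets. *)
Lemma sum_nat_le_ge0 (y : R) N : 0 <= y -> \sum_(j < N) (j.+1%:R <= y)%R%:R <= y.
Proof.
move=> y0; elim: N => [|N IH]; first by rewrite big_ord0.
rewrite big_ord_recr /=; case: (lerP N.+1%:R y) => yN; last by rewrite addr0.
apply: le_trans yN; rewrite -natr1 lerD2r.
rewrite -[N in leRHS]card_ord -sum1_card natr_sum.
by apply: ler_sum => j _; rewrite lern1 leq_b1.
Qed.

Lemma sum_nat_le_ceil (y : R) N : y <= N%:R -> y <= \sum_(j < N) (j.+1%:R <= y)%R%:R + 1.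
Proof.
elim: N => [|N IH] yN; first by rewrite big_ord0 add0r (le_trans yN).
rewrite big_ord_recr /=.
have [/IH h|Ny] := lerP y N%:R.
  by apply: (le_trans h); rewrite lerD2r lerDl ler0n.
rewrite (eq_bigr (fun=> 1)) => [|j _].
  rewrite sumr_const card_ord; apply: (le_trans yN).
  by rewrite -natr1 lerD2r lerDl ler0n.
by rewrite (le_trans _ (ltW Ny))// ler_nat.
Qed.

End Elementary.

Section Averages.
Context (R : realType) (k : nat).
Implicit Types (p q : 'I_k -> R).

Definition uniform_mean (h : 'I_k -> R) : R := k%:R^-1 * \sum_(x < k) h x.

Lemma uniform_mean_sqr_dev h (c := uniform_mean h) : (0 < k)%N ->
  uniform_mean (fun x => h x ^+ 2) = c ^+ 2 + uniform_mean (fun x => (h x - c) ^+ 2).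
Proof.
move=> k0; have kn0 : k%:R != 0 :> R by rewrite pnatr_eq0 -lt0n.
have hc : \sum_(x < k) h x = k%:R * c by rewrite /c /uniform_mean mulrA divff// mul1r.
rewrite /uniform_mean.
have -> : \sum_(x < k) (h x - c) ^+ 2 =
   \sum_(x < k) h x ^+ 2 - 2 * c * \sum_(x < k) h x + k%:R * c ^+ 2.
  have -> : k%:R * c ^+ 2 = \sum_(x < k) c ^+ 2 by rewrite sumr_const card_ord mulr_natl.
  rewrite mulr_sumr -sumrB -big_split /=.
  by apply: eq_bigr => x _; ring.
by rewrite hc; field.
Qed.

Lemma le_uniform_mean h h' : (forall x, h x <= h' x) -> uniform_mean h <= uniform_mean h'.
Proof. by move=> hh; rewrite ler_wpM2l ?invr_ge0// ler_sum. Qed.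

Lemma sqr_uniform_mean_le h : (0 < k)%N ->
  uniform_mean h ^+ 2 <= uniform_mean (fun x => h x ^+ 2).
Proof.
move=> k0; rewrite uniform_mean_sqr_dev// lerDl mulr_ge0 ?invr_ge0//.
by apply: sumr_ge0 => x _; exact: sqr_ge0.
Qed.

(* The deviations from the mean are orthogonal to it, so adding a multiple
   [eta] of their size costs only a factor [1 + eta ^+ 2] in mean square. *)
Lemma sqr_mean_add_dev_le h (eta : R) (g := uniform_mean h) : (0 < k)%N ->
  (g + eta * uniform_mean (fun x => `|h x - g|)) ^+ 2
    <= (1 + eta ^+ 2) * uniform_mean (fun x => h x ^+ 2).
Proof.
move=> k0; rewrite uniform_mean_sqr_dev// -/g.
have := sqr_uniform_mean_le (fun x => `|h x - g|) k0.
set D := uniform_mean (fun x => `|_|).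
rewrite /= (_ : uniform_mean (fun x => `|h x - g| ^+ 2)
  = uniform_mean (fun x => (h x - g) ^+ 2)); last first.
  by congr (_ * _); apply: eq_bigr => x _; rewrite real_normK ?num_real.
set V := uniform_mean _ => DV.
have : (1 + eta ^+ 2) * (g ^+ 2 + D ^+ 2) <= (1 + eta ^+ 2) * (g ^+ 2 + V).
  by rewrite ler_wpM2l ?lerD2l // addr_ge0 ?ler01 ?sqr_ge0.
have := sqr_ge0 (eta * g - D); nra.
Qed.

End Averages.

Section Iid.
Context (R : realType) (k : nat).
Implicit Types (p q w : 'I_k -> R) (G : seq 'I_k -> R).

(** The recursion peels off the first sample, [iid_mean_rcons] the last one, which is what a step of
    the state from time [t] to [t.+1] needs; [iid_mean_tuple] recovers the sum over tuples. *)
Fixpoint iid_mean p (n : nat) G : R :=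
  if n is n'.+1 then \sum_(x < k) p x * iid_mean p n' (fun s => G (x :: s))
  else G [::].

Lemma eq_iid_mean p n G G' : G =1 G' -> iid_mean p n G = iid_mean p n G'.
Proof.
elim: n G G' => [|n IH] G G' GG //=; apply: eq_bigr => x _.
by congr (_ * _); apply: IH => s; rewrite GG.
Qed.

Lemma iid_meanS p n G :
  iid_mean p n.+1 G = \sum_(x < k) p x * iid_mean p n (fun s => G (x :: s)).
Proof. by []. Qed.

Lemma iid_mean_rcons p n G :
  iid_mean p n.+1 G = \sum_(x < k) p x * iid_mean p n (fun s => G (rcons s x)).
Proof.
elim: n G => [//|n IH] G.
rewrite iid_meanS; under eq_bigr => x _ do rewrite IH mulr_sumr.
rewrite exchange_big /=; apply: eq_bigr => y _; rewrite mulr_sumr.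
by apply: eq_bigr => x _; rewrite mulrCA.
Qed.

Lemma iid_meanD p n G G' :
  iid_mean p n (fun s => G s + G' s) = iid_mean p n G + iid_mean p n G'.
Proof.
elim: n G G' => [//|n IH] G G' /=; rewrite -big_split /=.
by apply: eq_bigr => x _; rewrite IH mulrDr.
Qed.

Lemma iid_meanZ p n a G : iid_mean p n (fun s => a * G s) = a * iid_mean p n G.
Proof.
elim: n G => [//|n IH] G /=; rewrite mulr_sumr.
by apply: eq_bigr => x _; rewrite IH mulrCA.
Qed.

Lemma iid_mean_sum p n (T : Type) (r : seq T) (G : T -> seq 'I_k -> R) :
  iid_mean p n (fun s => \sum_(i <- r) G i s) = \sum_(i <- r) iid_mean p n (G i).
Proof.
elim: r => [|i r IH].
  rewrite big_nil -[RHS](mul0r (iid_mean p n (fun=> 0))) -iid_meanZ.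
  by apply: eq_iid_mean => s; rewrite big_nil mul0r.
by rewrite big_cons -IH -iid_meanD; apply: eq_iid_mean => s; rewrite big_cons.
Qed.

Lemma le_iid_mean p n G G' : (forall x, 0 <= p x) ->
  (forall s, size s = n -> G s <= G' s) -> iid_mean p n G <= iid_mean p n G'.
Proof.
move=> p0; elim: n G G' => [|n IH] G G' GG /=; first exact: GG.
by apply: ler_sum => x _; rewrite ler_wpM2l// IH// => s sn; rewrite GG//= sn.
Qed.

Lemma iid_mean_ge0 p n G : (forall x, 0 <= p x) ->
  (forall s, 0 <= G s) -> 0 <= iid_mean p n G.
Proof.
move=> p0; elim: n G => [|n IH] G G0 /=; first exact: G0.
by apply: sumr_ge0 => x _; rewrite mulr_ge0// IH.
Qed.

Lemma iid_mean_cst p n a : \sum_(x < k) p x = 1 -> iid_mean p n (fun=> a) = a.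
Proof. by move=> p1; elim: n => [//|n IH] /=; rewrite -mulr_suml p1 mul1r. Qed.

Lemma iid_mean_prod p n w :
  iid_mean p n (fun s => \prod_(x <- s) w x) = (\sum_(x < k) p x * w x) ^+ n.
Proof.
elim: n => [|n IH] /=; first by rewrite big_nil expr0.
rewrite exprS mulr_suml; apply: eq_bigr => x _.
rewrite -IH -mulrA; congr (_ * _); rewrite -iid_meanZ.
by apply: eq_iid_mean => s; rewrite big_cons.
Qed.

(** Change of measure: the product of the [w x] is the likelihood ratio of the sample. *)
Lemma iid_mean_reweight q w n G :
  iid_mean (fun x => q x * w x) n G =
  iid_mean q n (fun s => (\prod_(x <- s) w x) * G s).
Proof.
elim: n G => [|n IH] G /=; first by rewrite big_nil mul1r.
apply: eq_bigr => x _; rewrite IH -mulrA; congr (_ * _); rewrite -iid_meanZ.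
by apply: eq_iid_mean => s; rewrite big_cons mulrA.
Qed.

Lemma iid_mean_tuple p n G :
  iid_mean p n G = \sum_(s : n.-tuple 'I_k) (\prod_(j < n) p (tnth s j)) * G s.
Proof.
elim: n G => [|n IH] G /=.
  rewrite (big_pred1 [tuple]) ?big_ord0 ?mul1r // => s.
  by apply/esym/eqP; rewrite [s]tuple0.
under eq_bigr => x _ do rewrite IH mulr_sumr.
rewrite pair_bigA /=.
rewrite (reindex (fun u : 'I_k * n.-tuple 'I_k => cons_tuple u.1 u.2)) /=; last first.
  exists (fun s : n.+1.-tuple 'I_k => (thead s, [tuple of behead s])).
    by case=> x s _ /=; congr pair; apply/val_inj.
  by move=> s _ /=; rewrite [RHS](tuple_eta s); apply/val_inj.
apply: eq_bigr => -[x s] _ /=; rewrite big_ord_recl mulrA tnth0; congr (_ * _ * _).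
by apply: eq_bigr => j _; rewrite tnthS.
Qed.

(** Privacy keeps every [F x] within [(expR eps - 1) * m] of the mean [m] of [F] under [q]. Since
    [p] and [q] have equal mass, [m] can be subtracted from [F], so only these deviations are
    weighted by [p - q]. *)
Lemma one_sample_private (p q F : 'I_k -> R) (eps tau : R) :
  (forall x, 0 <= q x) -> \sum_(x < k) p x = 1 -> \sum_(x < k) q x = 1 ->
  \sum_(x < k) `|p x - q x| <= tau ->
  (forall x, 0 <= F x) -> (forall x y, F x <= expR eps * F y) -> 0 <= eps ->
  \sum_(x < k) p x * F x <= (1 + tau * (expR eps - 1)) * \sum_(x < k) q x * F x.
Proof.
move=> q0 p1 q1 pq F0 FF e0.
set m := \sum_(x < k) q x * F x.
have m0 : 0 <= m by apply: sumr_ge0 => x _; rewrite mulr_ge0.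
have E1 : 1 <= expR eps by rewrite -expR0 ler_expR.
have Fm x : `|F x - m| <= (expR eps - 1) * m.
  have h1 : F x <= expR eps * m.
    rewrite mulr_sumr -[leLHS]mul1r -q1 mulr_suml; apply: ler_sum => y _.
    by rewrite mulrCA ler_wpM2l.
  have h2 : m <= expR eps * F x.
    rewrite -[leRHS]mul1r -q1 mulr_suml; apply: ler_sum => y _.
    by rewrite ler_wpM2l.
  have h3 : F x - m <= (expR eps - 1) * m by lra.
  rewrite ler_norml h3 andbT.
  have [//|mF] := lerP m (F x); first by nra.
  have : (expR eps - 1) * F x <= (expR eps - 1) * m by rewrite ler_wpM2l; lra.
  lra.
have -> : \sum_(x < k) p x * F x = m + \sum_(x < k) (p x - q x) * (F x - m).
  have -> : \sum_(x < k) (p x - q x) * (F x - m)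
    = \sum_(x < k) p x * F x - m - ((\sum_(x < k) p x - \sum_(x < k) q x) * m).
    rewrite /m -!sumrB mulr_suml -sumrB; apply: eq_bigr => x _; ring.
  by rewrite p1 q1; ring.
rewrite mulrDl mul1r lerD2l -mulrA.
apply: (@le_trans _ _ (\sum_(x < k) `|p x - q x| * ((expR eps - 1) * m))).
  apply: ler_sum => x _; apply: le_trans (ler_norm _) _.
  by rewrite normrM ler_wpM2l.
by rewrite -mulr_suml ler_wpM2r// mulr_ge0// subr_ge0.
Qed.

(* Replacing the samples one by one: a single sample is changed with
   probability about [tau], and privacy bounds the effect of a change. *)
Lemma iid_mean_private p q (eps tau : R) n G :
  (forall x, 0 <= p x) -> (forall x, 0 <= q x) ->
  \sum_(x < k) p x = 1 -> \sum_(x < k) q x = 1 ->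
  \sum_(x < k) `|p x - q x| <= tau -> 0 <= eps ->
  (forall s, 0 <= G s) ->
  (forall s s', neighbors s s' -> G s <= expR eps * G s') ->
  iid_mean p n G <= (1 + tau * (expR eps - 1)) ^+ n * iid_mean q n G.
Proof.
move=> p0 q0 p1 q1 pq e0.
have tau0 : 0 <= tau by apply: le_trans pq; apply: sumr_ge0.
have K0 : 0 <= 1 + tau * (expR eps - 1).
  by rewrite addr_ge0// mulr_ge0// subr_ge0 -expR0 ler_expR.
elim: n G => [|n IH] G G0 GG /=; first by rewrite expr0 mul1r.
set K := (1 + _) in K0 IH *.
(* The induction hypothesis exchanges all samples after the first; the first is then exchanged with
   the rest averaged out. *)
apply: (@le_trans _ _ (K ^+ n * \sum_(x < k) p x * iid_mean q n (fun s => G (x :: s)))).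
  rewrite mulr_sumr; apply: ler_sum => x _; rewrite mulrCA ler_wpM2l//.
  apply: IH => // s s' [s1 [y [y' [s2 [-> ->]]]]].
  by apply: GG; exists (x :: s1), y, y', s2.
rewrite exprSr -mulrA ler_wpM2l ?exprn_ge0//.
apply: one_sample_private => // [x|x y]; first exact: iid_mean_ge0.
rewrite -iid_meanZ; apply: le_iid_mean => // s _.
by apply: GG; exists [::], x, y, s.
Qed.

End Iid.

(** * Bounded functions of the internal state *)

Section BoundedMeasurable.
Context (R : realType) (d : measure_display) (T : measurableType d).
Implicit Types (f g : T -> R).

(** This class of test functions is stable under sums, products and kernels, and all its integrals
    are finite, so that expectations can be computed in [R]. *)
Definition bounded_measurable f : Prop :=
  measurable_fun setT f /\ exists M, forall i, `|f i| <= M.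

Lemma bounded_measurable_cst (a : R) : bounded_measurable (fun=> a).
Proof. by split; [exact: measurable_cst | exists `|a|]. Qed.

Lemma bounded_measurableD f g : bounded_measurable f -> bounded_measurable g ->
  bounded_measurable (fun i => f i + g i).
Proof.
move=> [mf [M fM]] [mg [N gN]]; split; first exact: measurable_funD.
by exists (M + N) => i; rewrite (le_trans (ler_normD _ _))// lerD.
Qed.

Lemma bounded_measurableM f g : bounded_measurable f -> bounded_measurable g ->
  bounded_measurable (fun i => f i * g i).
Proof.
move=> [mf [M fM]] [mg [N gN]]; split; first exact: measurable_funM.
by exists (M * N) => i; rewrite normrM ler_pM.
Qed.

Lemma bounded_measurableZ (a : R) f : bounded_measurable f ->
  bounded_measurable (fun i => a * f i).
Proof. exact/bounded_measurableM/bounded_measurable_cst. Qed.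

Lemma bounded_measurableX f : bounded_measurable f ->
  bounded_measurable (fun i => f i ^+ 2).
Proof. by move=> mf; exact: bounded_measurableM. Qed.

Lemma bounded_measurableB f g : bounded_measurable f -> bounded_measurable g ->
  bounded_measurable (fun i => f i - g i).
Proof.
move=> mf /(bounded_measurableZ (-1)) mg.
under eq_fun do rewrite -mulN1r; exact: bounded_measurableD.
Qed.

Lemma bounded_measurable_norm f : bounded_measurable f ->
  bounded_measurable (fun i => `|f i|).
Proof.
move=> [mf [M fM]]; split; first exact: measurableT_comp.
by exists M => i; rewrite normr_id.
Qed.

Lemma bounded_measurable_sum (J : Type) (r : seq J) (f : J -> T -> R) :
  (forall j, bounded_measurable (f j)) ->
  bounded_measurable (fun i => \sum_(j <- r) f j i).
Proof.
move=> mf; elim: r => [|j r IH].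
  by under eq_fun do rewrite big_nil; exact: bounded_measurable_cst.
by under eq_fun do rewrite big_cons; exact: bounded_measurableD.
Qed.

Lemma bounded_measurable_indic (B : set T) : measurable B ->
  bounded_measurable (\1_B : T -> R).
Proof.
move=> mB; split; first exact: measurable_indic.
by exists 1 => i; rewrite ger0_norm ?indicE ?lern1 ?leq_b1.
Qed.

Section Mean.
Context (mu : {measure set T -> \bar R}) (mu1 : (mu setT = 1)%E).

Lemma bounded_measurable_integrable f :
  bounded_measurable f -> mu.-integrable setT (EFin \o f).
Proof.
move=> [mf [M fM]]; apply: measurable_bounded_integrable => //.
  by rewrite mu1 ltry.
exists M; split; first exact: num_real.
by move=> x Mx i _ /=; rewrite (le_trans (fM i))// ltW.
Qed.

Lemma EFin_mean f : bounded_measurable f ->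
  (\int[mu]_i f i)%:E = (\int[mu]_i (f i)%:E)%E.
Proof. by move=> /bounded_measurable_integrable mf; rewrite fineK// integrable_fin_num. Qed.

Lemma mean_cst (a : R) : \int[mu]_i a = a.
Proof. by rewrite Rintegral_cst// mu1 mulr1. Qed.

Lemma meanD f g : bounded_measurable f -> bounded_measurable g ->
  \int[mu]_i (f i + g i) = \int[mu]_i f i + \int[mu]_i g i.
Proof. by move=> mf mg; rewrite RintegralD//; exact: bounded_measurable_integrable. Qed.

Lemma meanZ (a : R) f : bounded_measurable f ->
  \int[mu]_i (a * f i) = a * \int[mu]_i f i.
Proof. by move=> mf; rewrite RintegralZl//; exact: bounded_measurable_integrable. Qed.

Lemma le_mean f g : bounded_measurable f -> bounded_measurable g ->
  (forall i, f i <= g i) -> \int[mu]_i f i <= \int[mu]_i g i.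
Proof. by move=> mf mg fg; apply: le_Rintegral => //; exact: bounded_measurable_integrable. Qed.

Lemma sqr_mean_le f : bounded_measurable f ->
  (\int[mu]_i f i) ^+ 2 <= \int[mu]_i (f i ^+ 2).
Proof.
move=> mf; set c := \int[mu]_i f i.
(* Jensen's inequality by integrating the tangent line of the square at the mean [c]. *)
have : \int[mu]_i (2 * c * f i + (- c ^+ 2)) <= \int[mu]_i (f i ^+ 2).
  apply: le_mean.
  - exact/bounded_measurableD/bounded_measurable_cst/bounded_measurableZ.
  - exact: bounded_measurableX.
  - by move=> i; have := sqr_ge0 (f i - c); nra.
rewrite meanD; [|exact: bounded_measurableZ|exact: bounded_measurable_cst].
by rewrite meanZ// mean_cst -/c; nra.
Qed.

End Mean.

End BoundedMeasurable.

Lemma bounded_measurable_kernel (R : realType) (d d' : measure_display)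
    (X : measurableType d) (T : measurableType d') (l : R.-pker X ~> T) (f : T -> R) :
  bounded_measurable f -> bounded_measurable (fun x => \int[l x]_i f i).
Proof.
move=> mf; have [_ [M fM]] := mf.
(* Measurability of a kernel integral is taken from the nonnegative case, after shifting [f] by its
   bound [M]. *)
have mfM : bounded_measurable (fun i => f i + M).
  exact/bounded_measurableD/bounded_measurable_cst.
have M0 i : 0 <= f i + M by move: (fM i); rewrite ler_norml => /andP[]; lra.
have l1 x : (l x setT = 1)%E by exact: prob_kernel.
have lE x : \int[l x]_i f i = \int[l x]_i (f i + M) - M.
  rewrite meanD ?mean_cst ?addrK ?prob_kernel//; exact: bounded_measurable_cst.
split.
  under eq_fun do rewrite lE; apply: measurable_funB => //.
  apply/measurable_EFinP; rewrite /comp.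
  under eq_fun do rewrite EFin_mean ?prob_kernel//.
  apply: measurable_fun_integral_kernel.
  - exact: measurable_kernel.
  - by move=> i; rewrite lee_fin.
  - by apply/measurable_EFinP; case: mfM.
exists M => x; rewrite ler_norml; apply/andP; split.
  rewrite -[leLHS](mean_cst (l1 x)).
  apply: le_mean => //; rewrite ?prob_kernel//; first exact: bounded_measurable_cst.
  by move=> i; move: (fM i); rewrite ler_norml => /andP[].
rewrite -[leRHS](mean_cst (l1 x)).
apply: le_mean => //; rewrite ?prob_kernel//; first exact: bounded_measurable_cst.
by move=> i; move: (fM i); rewrite ler_norml => /andP[].
Qed.

(** * Expectations over the internal state, and privacy for them *)

Section StateMean.
Context (R : realType) (k : nat).
Context (dI : measure_display) (I : measurableType dI).
Context (dO : measure_display) (O : measurableType dO).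
Variable A : stream_algorithm R k I O.
Implicit Types (f g : I -> R) (s : seq 'I_k).

(** The dual action of the update kernel: functions of the state are pulled back through a letter,
    and [run] composes these pullbacks along a stream. *)
Definition step (x : 'I_k) f : I -> R := fun i => \int[update A x i]_j f j.

Definition run s f : I -> R := foldr step f s.

Definition state_mean s f : R := \int[initial A]_i run s f i.

Let pk x i : (update A x i setT = 1)%E. Proof. exact: prob_kernel. Qed.

Let i1 : (initial A setT = 1)%E. Proof. exact: probability_setT. Qed.

Lemma bounded_measurable_step x f :
  bounded_measurable f -> bounded_measurable (step x f).
Proof. exact: bounded_measurable_kernel. Qed.

Lemma bounded_measurable_run s f :
  bounded_measurable f -> bounded_measurable (run s f).
Proof. by move=> mf; elim: s => //= x s IH; exact: bounded_measurable_step. Qed.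

Lemma state_mean_rcons s x f : state_mean (rcons s x) f = state_mean s (step x f).
Proof. by rewrite /state_mean /run foldr_rcons. Qed.

Lemma expect_fromE s f i : bounded_measurable f ->
  expect_from A s (EFin \o f) i = (run s f i)%:E.
Proof.
move=> mf; elim: s i => [//|x s IH] i /=.
under eq_integral do rewrite IH.
by rewrite -EFin_mean//; exact: bounded_measurable_run.
Qed.

Lemma integral_expect_from s f : bounded_measurable f ->
  (\int[initial A]_i expect_from A s (EFin \o f) i)%E = (state_mean s f)%:E.
Proof.
move=> mf; under eq_integral do rewrite expect_fromE//.
by rewrite -EFin_mean//; exact: bounded_measurable_run.
Qed.

Lemma run_cst s (a : R) : run s (fun=> a) = fun=> a.
Proof.
by elim: s => //= x s IH; rewrite IH; apply/funext => i; rewrite /step mean_cst.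
Qed.

Lemma state_mean_cst s (a : R) : state_mean s (fun=> a) = a.
Proof. by rewrite /state_mean run_cst mean_cst. Qed.

Lemma runD s f g : bounded_measurable f -> bounded_measurable g ->
  run s (fun i => f i + g i) = fun i => run s f i + run s g i.
Proof.
move=> mf mg; elim: s => //= x s IH; rewrite IH; apply/funext => i.
by rewrite /step meanD//; exact: bounded_measurable_run.
Qed.

Lemma state_meanD s f g : bounded_measurable f -> bounded_measurable g ->
  state_mean s (fun i => f i + g i) = state_mean s f + state_mean s g.
Proof.
by move=> mf mg; rewrite /state_mean runD// meanD//; exact: bounded_measurable_run.
Qed.

Lemma runZ s (a : R) f : bounded_measurable f ->
  run s (fun i => a * f i) = fun i => a * run s f i.
Proof.
move=> mf; elim: s => //= x s IH; rewrite IH; apply/funext => i.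
by rewrite /step meanZ//; exact: bounded_measurable_run.
Qed.

Lemma state_meanZ s (a : R) f : bounded_measurable f ->
  state_mean s (fun i => a * f i) = a * state_mean s f.
Proof.
by move=> mf; rewrite /state_mean runZ// meanZ//; exact: bounded_measurable_run.
Qed.

Lemma state_mean_sum s (J : Type) (r : seq J) (f : J -> I -> R) :
  (forall j, bounded_measurable (f j)) ->
  state_mean s (fun i => \sum_(j <- r) f j i) = \sum_(j <- r) state_mean s (f j).
Proof.
move=> mf; elim: r => [|j r IH].
  by under eq_fun do rewrite big_nil; rewrite big_nil state_mean_cst.
under eq_fun do rewrite big_cons.
by rewrite big_cons state_meanD ?IH//; exact: bounded_measurable_sum.
Qed.

Lemma le_state_mean s f g : bounded_measurable f -> bounded_measurable g ->
  (forall i, f i <= g i) -> state_mean s f <= state_mean s g.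
Proof.
move=> mf mg fg; apply: le_mean; rewrite ?i1//; try exact: bounded_measurable_run.
elim: s => //= x s IH i; apply: le_mean => //; exact: bounded_measurable_run.
Qed.

Lemma state_mean_ge0 s f : bounded_measurable f ->
  (forall i, 0 <= f i) -> 0 <= state_mean s f.
Proof.
move=> mf f0; rewrite -(state_mean_cst s 0); apply: le_state_mean => //.
exact: bounded_measurable_cst.
Qed.

Lemma sqr_step_le x f i : bounded_measurable f ->
  step x f i ^+ 2 <= step x (fun j => f j ^+ 2) i.
Proof. by move=> mf; exact: sqr_mean_le. Qed.

(** The snapshot is taken at the end of the stream and the output is left free. As streams have
    arbitrary length, applying this to prefixes controls the state at every time. *)
Lemma pan_private_indic (eps : R) s s' (B : set I) :
  pan_private eps A -> neighbors s s' -> measurable B ->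
  state_mean s \1_B <= expR eps * state_mean s' \1_B.
Proof.
move=> priv ss mB.
have jE u : (joint_prob A u (size u) (B `*` setT) = (state_mean u \1_B)%:E)%E.
  rewrite -integral_expect_from; last exact: bounded_measurable_indic.
  rewrite /joint_prob take_size drop_size /=.
  apply: eq_integral => i _; congr (expect_from A u _ i); apply/funext => j /=.
  rewrite indicE; have [jB|jB] := boolP (j \in B).
    by rewrite in_xsectionX// ?prob_kernel.
  by rewrite notin_xsectionX// measure0.
have sz : size s' = size s.
  by have [s1 [x [x' [s2 [-> ->]]]]] := ss; rewrite !size_cat.
have := priv s s' ss (size s).
rewrite leqnn andbT.
have -> : (0 < size s)%N.
  by have [s1 [x [x' [s2 [-> _]]]]] := ss; rewrite size_cat /= addnS.
move=> /(_ isT (B `*` setT)); rewrite jE -[in joint_prob A s' _ _]sz jE -EFinM lee_fin; apply.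
exact: measurableX.
Qed.

(* Privacy only constrains events; a bounded function is uniformly
   approximated by averages of indicators of its superlevel sets. *)
Lemma pan_private_mean (eps : R) s s' f :
  pan_private eps A -> neighbors s s' ->
  bounded_measurable f -> (forall i, 0 <= f i) ->
  state_mean s f <= expR eps * state_mean s' f.
Proof.
move=> priv ss mf f0.
have [meas [M fM]] := mf.
apply/ler_addgt0Pr => e e0.
(* The grid has mesh [n.+1%:R^-1 < e], and [N] levels of it exceed [f]; [h] below is [f] rounded
   down to this grid. *)
have [n ne] : exists n : nat, e^-1 < n.+1%:R.
  by exists (Num.truncn e^-1); exact: truncnS_gt.
have [N fN] : exists N : nat, forall i, n.+1%:R * f i <= N%:R.
  exists (Num.truncn (n.+1%:R * M)).+1 => i.
  apply: le_trans (ltW (truncnS_gt _)).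
  by rewrite ler_wpM2l// (le_trans (ler_norm _)).
pose B (j : nat) := [set i | j.+1%:R <= n.+1%:R * f i].
have mB j : measurable (B j).
  rewrite -[B j]setTI.
  by apply: measurable_fun_le => //; apply: measurable_funM.
have bB j := bounded_measurable_indic R (mB j).
pose h i : R := n.+1%:R^-1 * \sum_(j < N) \1_(B j) i.
have hE i : h i = n.+1%:R^-1 * \sum_(j < N) (j.+1%:R <= n.+1%:R * f i)%R%:R.
  by congr (_ * _); apply: eq_bigr => j _; rewrite indicE mem_setE.
have n0 : 0 < n.+1%:R :> R by rewrite ltr0n.
have hf i : h i <= f i.
  by rewrite hE ler_pdivrMl// sum_nat_le_ge0// mulr_ge0.
have fh i : f i <= h i + e.
  rewrite -(ler_pM2l n0) mulrDr hE mulrA divff ?gt_eqF// mul1r.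
  apply: (le_trans (sum_nat_le_ceil (fN i))); rewrite lerD2l.
  by rewrite -ler_pdivrMr// mul1r ltW.
have mh : bounded_measurable h.
  by apply/bounded_measurableZ/bounded_measurable_sum.
apply: (@le_trans _ _ (state_mean s h + e)).
  rewrite -[e in leRHS](state_mean_cst s) -state_meanD//; last exact: bounded_measurable_cst.
  apply: le_state_mean => //.
  exact/bounded_measurableD/bounded_measurable_cst.
rewrite lerD2r; apply: (@le_trans _ _ (expR eps * state_mean s' h)).
  rewrite /h !state_meanZ; try exact: bounded_measurable_sum.
  rewrite mulrCA ler_wpM2l ?invr_ge0// !state_mean_sum// mulr_sumr.
  by apply: ler_sum => j _; exact: pan_private_indic.
by rewrite ler_wpM2l ?expR_ge0//; exact: le_state_mean.
Qed.

End StateMean.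

(** * Randomly perturbed uniform distributions *)

Section FiniteMean.
Context (R : realType) (T : finType).
Implicit Types (F G : T -> R).

Definition fin_mean F : R := #|T|%:R^-1 * \sum_t F t.

Lemma eq_fin_mean F G : F =1 G -> fin_mean F = fin_mean G.
Proof. by move=> FG; congr (_ * _); apply: eq_bigr. Qed.

Lemma fin_meanD F G : fin_mean (fun t => F t + G t) = fin_mean F + fin_mean G.
Proof. by rewrite /fin_mean big_split mulrDr. Qed.

Lemma fin_meanZ (a : R) F : fin_mean (fun t => a * F t) = a * fin_mean F.
Proof. by rewrite /fin_mean -mulr_sumr mulrCA. Qed.

Lemma fin_mean_sum (J : Type) (r : seq J) (F : J -> T -> R) :
  fin_mean (fun t => \sum_(j <- r) F j t) = \sum_(j <- r) fin_mean (F j).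
Proof. by rewrite /fin_mean exchange_big mulr_sumr. Qed.

Lemma le_fin_mean F G : (forall t, F t <= G t) -> fin_mean F <= fin_mean G.
Proof. by move=> FG; rewrite ler_wpM2l ?invr_ge0// ler_sum. Qed.

Lemma ler_norm_fin_mean F : `|fin_mean F| <= fin_mean (fun t => `|F t|).
Proof. by rewrite normrM ger0_norm ?invr_ge0// ler_wpM2l ?invr_ge0// ler_norm_sum. Qed.

Lemma fin_mean_cst (a : R) : T -> fin_mean (fun=> a) = a.
Proof.
move=> t; rewrite /fin_mean sumr_const -[a *+ _]mulr_natl mulrA mulVf ?mul1r//.
by rewrite pnatr_eq0 -lt0n; apply/card_gt0P; exists t.
Qed.

Lemma fin_mean_inj (h : T -> T) F : injective h ->
  fin_mean (fun t => F (h t)) = fin_mean F.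
Proof. by move=> hi; congr (_ * _); rewrite [RHS](reindex_inj hi). Qed.

End FiniteMean.

(* The perturbation of letter [x] is [a x (theta (blk x))], for [theta] uniform in
   [{ffun 'I_r -> 'I_6}]: the blocks are perturbed independently. *)
Record block_design (R : realType) (k r : nat) (blk : 'I_k -> 'I_r)
    (a : 'I_k -> 'I_6 -> R) : Prop := BlockDesign {
  design_ge : forall x v, -1 <= a x v ;
  design_le : forall x v, a x v <= 2 ;
  design_norm : forall x v, 1 <= `|a x v| ;
  design_centered : forall x, \sum_v a x v = 0 ;
  design_balanced : forall b v, \sum_(x | blk x == b) a x v = 0 ;
  design_card : forall b, (#|[pred x | blk x == b]| <= 3)%N }.

(** * Construction of the blocks *)

Section BlockDesignExists.
Context (R : realType) (k r : nat).
Hypothesis kr : k = (r.+1.*2 + odd k)%N.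

(* Consecutive pairs of letters, with a final triple when [k] is odd; reduction
   mod 2 and mod 3 both map ['I_6] uniformly. One letter of the block, chosen by
   [v], gains what the others lose. *)
Let size_of (b : nat) : nat := (2 + (odd k && (b == r)))%N.
Let blk (x : 'I_k) : 'I_r.+1 := inord (minn x./2 r).

Let blkE (x : 'I_k) : blk x = minn x./2 r :> nat.
Proof. by rewrite inordK// ltnS geq_minr. Qed.

Let block_lt b i : (b <= r)%N -> (i < size_of b)%N -> (b.*2 + i < k)%N.
Proof. by rewrite /size_of; move: kr; case: (odd k); case: eqP => /=; lia. Qed.

Let block_half b i : (b <= r)%N -> (i < size_of b)%N -> minn (b.*2 + i)./2 r = b.
Proof. by rewrite /size_of; move: kr; case: (odd k); case: eqP => /=; lia. Qed.

Let block_offset x : (x < k)%N -> (x - (minn x./2 r).*2 < size_of (minn x./2 r))%N.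
Proof. by rewrite /size_of; move: kr; case: (odd k); case: eqP => /=; lia. Qed.

Let big_block (b : 'I_r.+1) (G : nat -> R) :
  \sum_(x | blk x == b) G x = \sum_(i < size_of b) G (b.*2 + i)%N.
Proof.
have br : (b <= r)%N by rewrite -ltnS.
have bk (i : 'I_(size_of b)) : (b.*2 + i < k)%N by exact: block_lt.
(* Letters of block [b] are reindexed by their offset from its first letter [b.*2]. *)
rewrite (reindex_onto (fun i => Ordinal (bk i))
   (fun x => inord (x - b.*2) : 'I_(size_of b).-1.+1)) /=; last first.
  move=> x /eqP xb; apply/val_inj => /=; have xk := ltn_ord x.
  have bE : minn x./2 r = b by rewrite -blkE xb.
  by rewrite inordK -?bE; [lia | exact: block_offset].
apply: eq_bigl => i; apply/andP; split.
  by apply/eqP/ord_inj; rewrite blkE block_half.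
by apply/eqP/val_inj; rewrite /= addKn inordK.
Qed.

Let a (x : 'I_k) (v : 'I_6) : R :=
  (size_of (blk x))%:R * (v %% size_of (blk x) == x - (blk x).*2)%N%:R - 1.

Lemma consecutive_block_design : block_design blk a.
Proof.
have size23 b : size_of b = 2 \/ size_of b = 3.
  by rewrite /size_of; case: (_ && _); [right|left].
split.
- by move=> x v; rewrite lerBrDr addNr mulr_ge0.
- move=> x v; rewrite lerBlDr /a; case: (_ == _); rewrite ?mulr0 ?mulr1; last by lra.
  by case: (size23 (blk x)) => ->; lra.
- move=> x v; rewrite /a; case: (_ == _); rewrite ?mulr0 ?mulr1 ?sub0r ?normrN1//.
  by case: (size23 (blk x)) => ->; rewrite ger0_norm; lra.
- move=> x; rewrite /a.
  have : (x - (blk x).*2 < size_of (blk x))%N.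
    by rewrite blkE; exact: block_offset.
  case: (size23 (blk x)) => ->; rewrite !big_ord_recl big_ord0 /=.
    by case: (_ - _)%N => [|[|]]//= _; lra.
  by case: (_ - _)%N => [|[|[|]]]//= _; lra.
- move=> b v.
  pose G (y : nat) : R := (size_of b)%:R * (v %% size_of b == y - b.*2)%N%:R - 1.
  transitivity (\sum_(x | blk x == b) G x).
    by apply: eq_bigr => x /eqP xb; rewrite /a xb.
  rewrite big_block /G.
  have : (v %% size_of b < size_of b)%N by rewrite ltn_mod.
  under eq_bigr => i _ do rewrite addKn.
  case: (size23 b) => ->; rewrite !big_ord_recl big_ord0 /=.
    by case: (_ %% _)%N => [|[|]]//= _; lra.
  by case: (_ %% _)%N => [|[|[|]]]//= _; lra.
- move=> b; rewrite -(ler_nat R) -sum1_card natr_sum.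
  rewrite (big_block b (fun=> 1)) sumr_const card_ord.
  by case: (size23 b) => ->; rewrite ler_nat.
Qed.

End BlockDesignExists.

Lemma block_design_exists (R : realType) (k : nat) : (2 <= k)%N ->
  exists (r : nat) (blk : 'I_k -> 'I_r) (a : 'I_k -> 'I_6 -> R),
    (r <= k)%N /\ block_design blk a.
Proof.
move=> k2; pose r := k./2.-1.
have kr : k = (r.+1.*2 + odd k)%N by rewrite /r; lia.
exists r.+1; do 2 eexists; split; last exact: (consecutive_block_design R kr).
by rewrite /r; lia.
Qed.

(** * The perturbed distributions: distances, correlations, exponential moments *)

Section Family.
Context (R : realType) (k r : nat) (blk : 'I_k -> 'I_r) (a : 'I_k -> 'I_6 -> R).
Context (D : block_design blk a) (delta : R) (k0 : (0 < k)%N).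
Hypotheses (d0 : 0 <= delta) (d1 : delta <= 1).

Notation Theta := {ffun 'I_r -> 'I_6}.
Implicit Types (th : Theta) (x : 'I_k) (v : 'I_6).

Definition pert th x : R := delta * a x (th (blk x)).

Definition pert_dist th x : R := uniform_dist R x * (1 + pert th x).

(** Adding it to [th] shifts the choice in block [b] by [v] modulo 6 and keeps the other blocks;
    uniform [th] is invariant under such translations. *)
Definition single (b : 'I_r) v : Theta := [ffun i => if i == b then v else 0].

Let kR : 0 < k%:R :> R. Proof. by rewrite ltr0n. Qed.

Let norm_a x v : `|a x v| <= 2.
Proof.
have h1 := design_ge D x v; have h2 := design_le D x v.
by rewrite ler_norml; apply/andP; split; lra.
Qed.

Lemma norm_pert_le th x : `|pert th x| <= 2 * delta.
Proof. by rewrite normrM (ger0_norm d0) mulrC ler_wpM2r. Qed.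

Lemma pert1_ge0 th x : 0 <= 1 + pert th x.
Proof.
have /(ler_wpM2l d0) := design_ge D x (th (blk x)); by move: d1; rewrite /pert mulrN1; lra.
Qed.

Lemma sum_by_blocks (F : 'I_k -> R) :
  \sum_x F x = \sum_(b < r) \sum_(x | blk x == b) F x.
Proof. by rewrite (partition_big blk predT). Qed.

Lemma sum_pert th : \sum_x pert th x = 0.
Proof.
rewrite sum_by_blocks big1// => b _; rewrite -mulr_sumr.
rewrite (eq_bigr (fun x => a x (th b))) => [|x /eqP ->//].
by rewrite (design_balanced D) mulr0.
Qed.

Lemma pert_dist_ge0 th x : 0 <= pert_dist th x.
Proof. by rewrite mulr_ge0 ?pert1_ge0// invr_ge0. Qed.

Let sum_cst (c : R) : k%:R * c = \sum_(x < k) c.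
Proof. by rewrite sumr_const card_ord mulr_natl. Qed.

Lemma sum_uniform : \sum_(x < k) uniform_dist R x = 1.
Proof. by rewrite /uniform_dist sumr_const card_ord -[LHS]mulr_natl divff// gt_eqF. Qed.

Lemma sum_pert_dist th : \sum_x pert_dist th x = 1.
Proof.
rewrite /pert_dist; under eq_bigr do rewrite mulrDr mulr1.
by rewrite big_split /= sum_uniform -mulr_sumr sum_pert mulr0 addr0.
Qed.

Lemma pert_dist_distribution th : is_distribution (pert_dist th).
Proof. by split; [exact: pert_dist_ge0 | exact: sum_pert_dist]. Qed.

Lemma pert_dist_diff th x : `|pert_dist th x - uniform_dist R x| = k%:R^-1 * `|pert th x|.
Proof.
rewrite /pert_dist mulrDr mulr1 addrC addKr normrM ger0_norm//.
by rewrite invr_ge0.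
Qed.

Lemma dTV_pert_dist th : delta / 2 <= dTV (pert_dist th) (@uniform_dist R k).
Proof.
rewrite /dTV mulrC ler_wpM2l// ?invr_ge0//.
under eq_bigr do rewrite pert_dist_diff.
rewrite -mulr_sumr ler_pdivlMl// sum_cst.
apply: ler_sum => x _; rewrite normrM (ger0_norm d0) -[leLHS]mulr1.
by rewrite ler_wpM2l// (design_norm D).
Qed.

Lemma sum_pert_dist_diff th :
  \sum_x `|pert_dist th x - uniform_dist R x| <= 2 * delta.
Proof.
under eq_bigr do rewrite pert_dist_diff.
rewrite -mulr_sumr ler_pdivrMl// sum_cst.
by apply: ler_sum => x _; exact: norm_pert_le.
Qed.

(** Only the letters of block [b] matter: at most three of them, each moving by at most
    [3 * delta / k%:R] because [a] takes values in [-1, 2]. *)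
Lemma sum_pert_dist_shift th b v :
  \sum_x `|pert_dist (th + single b v) x - pert_dist th x| <= 9 * delta / k%:R.
Proof.
rewrite (bigID (fun x => blk x == b)) /= [X in _ + X]big1 ?addr0 => [|x xb]; last first.
  by rewrite /pert_dist /pert !ffunE (negPf xb) addr0 subrr normr0.
apply: (@le_trans _ _ (\sum_(x | blk x == b) 3 * delta / k%:R)).
  apply: ler_sum => x _.
  have -> : pert_dist (th + single b v) x - pert_dist th x =
     k%:R^-1 * (delta * (a x ((th + single b v) (blk x)) - a x (th (blk x)))).
    by rewrite /pert_dist /pert /uniform_dist; ring.
  rewrite normrM ger0_norm ?invr_ge0// mulrC ler_wpM2r ?invr_ge0//.
  rewrite normrM (ger0_norm d0) mulrC ler_wpM2r// ler_norml.
  have := design_ge D x ((th + single b v) (blk x)).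
  have := design_le D x ((th + single b v) (blk x)).
  have := design_ge D x (th (blk x)); have := design_le D x (th (blk x)).
  by move=> *; apply/andP; split; lra.
rewrite sumr_const -[leLHS]mulr_natr.
have : #|[pred x | blk x == b]|%:R <= 3 :> R by rewrite ler_nat; exact: (design_card D).
have : 0 <= delta / k%:R by rewrite divr_ge0.
have -> : 9 * delta / k%:R = 3 * delta / k%:R * 3 by ring.
move=> h1 h2; rewrite ler_wpM2l// -mulrA mulr_ge0//.
Qed.

(* Averaging over the choice made in the block of [x] cancels any part of [mu]
   that does not depend on that choice. *)
Lemma pert_correlation_le x (u : R) (mu : Theta -> R) :
  (forall th, 0 <= mu th) ->
  (forall th v, mu (th + single (blk x) v) <= expR u * mu th) ->
  `|fin_mean (fun th => pert th x * mu th)| <= 4 * delta * u * fin_mean mu.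
Proof.
move=> mu0 muu; set b := blk x.
have muu' th v : mu th <= expR u * mu (th + single b v).
  have {1}-> : th = th + single b v + single b (- v).
    rewrite -addrA -[LHS]addr0; congr (_ + _); apply/ffunP => i.
    by rewrite !ffunE; case: ifP; rewrite ?addrN ?addr0.
  exact: muu.
have close (y z : R) : 0 <= y -> y <= expR u * z -> y - z <= u * y.
  move=> y0 yz; have := expR_ge1Dx (- u); rewrite expRN => h.
  have : (expR u)^-1 * y <= z by rewrite ler_pdivrMl ?expR_gt0.
  have : (1 - u) * y <= (expR u)^-1 * y by rewrite ler_wpM2r.
  lra.
have cancel th : \sum_(v < 6) pert (th + single b v) x = 0.
  have shift : \sum_(v < 6) a x (th b + v) = 0.
    by rewrite -[RHS](design_centered D x) [RHS](reindex_inj (addrI (th b))).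
  rewrite -mulr_sumr -[RHS](mulr0 delta); congr (_ * _); rewrite -[RHS]shift.
  by apply: eq_bigr => v _; rewrite !ffunE eqxx.
(* Average over the six translations of the block of [x]; by [cancel], the unshifted [mu th] can be
   subtracted for free. *)
have -> : fin_mean (fun th => pert th x * mu th) = fin_mean (fun th =>
   6^-1 * \sum_(v < 6) pert (th + single b v) x * (mu (th + single b v) - mu th)).
  rewrite fin_meanZ.
  have -> : fin_mean (fun th => \sum_(v < 6) pert (th + single b v) x *
      (mu (th + single b v) - mu th)) = fin_mean (fun th => \sum_(v < 6)
      pert (th + single b v) x * mu (th + single b v)).
    apply: eq_fin_mean => th; under eq_bigr do rewrite mulrBr.
    by rewrite sumrB -mulr_suml cancel mul0r subr0.
  rewrite fin_mean_sum; under eq_bigr => v _ do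
    rewrite (fin_mean_inj (fun th => pert th x * mu th) (@addIr _ (single b v))).
  by rewrite sumr_const card_ord -[X in 6^-1 * X]mulr_natl mulrA mulVf ?mul1r.
apply: (le_trans (ler_norm_fin_mean _)).
apply: (@le_trans _ _ (fin_mean (fun th => 6^-1 * \sum_(v < 6)
   (2 * delta * u) * (mu (th + single b v) + mu th)))).
  apply: le_fin_mean => th; rewrite normrM ger0_norm ?invr_ge0// ler_wpM2l ?invr_ge0//.
  apply: (le_trans (ler_norm_sum _ _ _)); apply: ler_sum => v _.
  rewrite normrM -[leRHS]mulrA; apply: ler_pM => //; first exact: norm_pert_le.
  have h1 := close _ _ (mu0 _) (muu th v); have h2 := close _ _ (mu0 _) (muu' th v).
  have u0 : 0 <= u * mu th + u * mu (th + single b v) by lra.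
  have [c|c] := leP (mu th) (mu (th + single b v)).
    rewrite ger0_norm; last by lra.
    have := mu0 th; nra.
  rewrite ltr0_norm; last by lra.
  have := mu0 (th + single b v); nra.
rewrite fin_meanZ fin_mean_sum.
under eq_bigr => v _ do rewrite fin_meanZ fin_meanD (fin_mean_inj mu (@addIr _ (single b v))).
rewrite sumr_const card_ord; set mm := fin_mean mu.
by rewrite -[X in 6^-1 * X]mulr_natl le_eqVlt; apply/orP; left; apply/eqP; field.
Qed.

(** Independence of the blocks factors the exponential moment; in each factor [expR_le_sqr] applies
    and its linear term averages to zero. *)
Lemma fin_mean_expR_le (z : 'I_r -> 'I_6 -> R) (Z : R) :
  (forall b, \sum_(v < 6) z b v = 0) -> (forall b v, `|z b v| <= Z) ->
  fin_mean (fun th : Theta => expR (\sum_(b < r) z b (th b))) <= expR (r%:R * (3 * Z ^+ 2)).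
Proof.
move=> zc zZ; rewrite /fin_mean.
under eq_bigr do rewrite expR_sum.
rewrite -(bigA_distr_bigA (fun b v => expR (z b v))) card_ffun !card_ord natrX -exprVn.
rewrite -[r in _ ^+ r]card_ord -prodr_const -big_split /=.
rewrite expRM_natl -[r in leRHS]card_ord -prodr_const.
apply: ler_prod => b _; apply/andP; split.
  by rewrite mulr_ge0 ?invr_ge0//; apply: sumr_ge0 => v _; exact: expR_ge0.
rewrite ler_pdivrMl//; apply: (@le_trans _ _ (\sum_(v < 6) (z b v + expR (3 * Z ^+ 2)))).
  apply: ler_sum => v _; apply: (le_trans (expR_le_sqr _)); rewrite lerD2l ler_expR.
  rewrite ler_wpM2l// -[z b v ^+ 2]real_normK ?num_real//.
  rewrite lerXn2r ?nnegrE// (le_trans _ (zZ b v))//.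
by rewrite big_split /= zc add0r sumr_const card_ord [leRHS]mulr_natl.
Qed.

(** With [th'] fixed, the power is at most the exponential of a sum of centered terms, one for each
    block. The 12 counts at most three letters, each with a product of two values of [a] of size at
    most 2. *)
Lemma fin_mean_inner_le (m : nat) (th' : Theta) :
  fin_mean (fun th : Theta =>
    (\sum_x uniform_dist R x * ((1 + pert th x) * (1 + pert th' x))) ^+ m)
  <= expR (r%:R * (3 * (12 * (m%:R * delta ^+ 2 / k%:R)) ^+ 2)).
Proof.
pose z (b : 'I_r) v : R := m%:R * delta ^+ 2 / k%:R * \sum_(x | blk x == b) a x v * a x (th' b).
apply: le_trans (fin_mean_expR_le (z := z) _ _).
- apply: le_fin_mean => th.
  have innerE : \sum_x uniform_dist R x * ((1 + pert th x) * (1 + pert th' x))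
      = 1 + k%:R^-1 * \sum_x pert th x * pert th' x.
    transitivity (\sum_x (uniform_dist R x + k%:R^-1 * pert th x + k%:R^-1 * pert th' x
       + k%:R^-1 * (pert th x * pert th' x))).
      by apply: eq_bigr => x _; rewrite /uniform_dist; ring.
    have out (F : 'I_k -> R) : \sum_x k%:R^-1 * F x = k%:R^-1 * \sum_x F x.
      by rewrite mulr_sumr.
    by rewrite !big_split /= sum_uniform !out !sum_pert; ring.
  have -> : \sum_(b < r) z b (th b) = m%:R * (k%:R^-1 * \sum_x pert th x * pert th' x).
    have -> : \sum_x pert th x * pert th' x = delta ^+ 2 *
        \sum_(b < r) \sum_(x | blk x == b) a x (th b) * a x (th' b).
      rewrite sum_by_blocks mulr_sumr; apply: eq_bigr => b _.
      by rewrite mulr_sumr; apply: eq_bigr => x /eqP xb; rewrite /pert xb; ring.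
    by rewrite -mulr_sumr; ring.
  rewrite innerE; apply: le_expR_mulrn; rewrite -innerE.
  by apply: sumr_ge0 => x _; rewrite mulr_ge0 ?invr_ge0 ?mulr_ge0 ?pert1_ge0.
- move=> b; rewrite -mulr_sumr exchange_big big1 ?mulr0// => x _.
  by rewrite -mulr_suml (design_centered D) mul0r.
- move=> b v; rewrite /z normrM ger0_norm; last by rewrite divr_ge0 ?mulr_ge0 ?sqr_ge0.
  rewrite mulrC ler_wpM2r ?divr_ge0 ?mulr_ge0 ?sqr_ge0//.
  apply: (le_trans (ler_norm_sum _ _ _)).
  apply: (@le_trans _ _ (\sum_(x | blk x == b) 4)).
    apply: ler_sum => x _; rewrite normrM.
    have -> : 4 = 2 * 2 :> R by ring.
    by rewrite ler_pM.
  rewrite sumr_const -[leLHS]mulr_natr.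
  have : #|[pred x | blk x == b]|%:R <= 3 :> R by rewrite ler_nat; exact: (design_card D).
  by move=> h; lra.
Qed.

End Family.

(** * Divergence of the mixture from the null *)

Lemma iid_mean_fin_mean (R : realType) (k : nat) (T : finType) (p : 'I_k -> R) n
    (G : T -> seq 'I_k -> R) :
  iid_mean p n (fun s => fin_mean (G ^~ s)) = fin_mean (fun t => iid_mean p n (G t)).
Proof. by rewrite /fin_mean -iid_mean_sum -iid_meanZ. Qed.

Section LawMean.
Context (R : realType) (k : nat).
Context (dI : measure_display) (I : measurableType dI).
Context (dO : measure_display) (O : measurableType dO).
Variable A : stream_algorithm R k I O.
Implicit Types (p : 'I_k -> R) (f g : I -> R).

Definition law_mean p (t : nat) f : R := iid_mean p t (fun s => state_mean A s f).

Lemma law_meanS p t f : law_mean p t.+1 f = \sum_x p x * law_mean p t (step A x f).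
Proof.
rewrite /law_mean iid_mean_rcons; apply: eq_bigr => x _; congr (_ * _).
by apply: eq_iid_mean => s; exact: state_mean_rcons.
Qed.

Lemma law_meanD p t f g : bounded_measurable f -> bounded_measurable g ->
  law_mean p t (fun i => f i + g i) = law_mean p t f + law_mean p t g.
Proof.
by move=> mf mg; rewrite -iid_meanD; apply: eq_iid_mean => s; exact: state_meanD.
Qed.

Lemma law_meanZ p t (a : R) f : bounded_measurable f ->
  law_mean p t (fun i => a * f i) = a * law_mean p t f.
Proof.
by move=> mf; rewrite -iid_meanZ; apply: eq_iid_mean => s; exact: state_meanZ.
Qed.

Lemma law_meanB p t f g : bounded_measurable f -> bounded_measurable g ->
  law_mean p t (fun i => f i - g i) = law_mean p t f - law_mean p t g.
Proof.
move=> mf mg; rewrite -[- law_mean p t g]mulN1r -law_meanZ// -law_meanD//.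
  by congr law_mean; apply/funext => i; rewrite mulN1r.
exact: bounded_measurableZ.
Qed.

Lemma law_mean_sum p t (J : Type) (r : seq J) (f : J -> I -> R) :
  (forall j, bounded_measurable (f j)) ->
  law_mean p t (fun i => \sum_(j <- r) f j i) = \sum_(j <- r) law_mean p t (f j).
Proof.
by move=> mf; rewrite -iid_mean_sum; apply: eq_iid_mean => s; exact: state_mean_sum.
Qed.

Lemma le_law_mean p t f g : (forall x, 0 <= p x) ->
  bounded_measurable f -> bounded_measurable g ->
  (forall i, f i <= g i) -> law_mean p t f <= law_mean p t g.
Proof. by move=> p0 mf mg fg; apply: le_iid_mean => // s _; exact: le_state_mean. Qed.

Lemma law_mean_ge0 p t f : (forall x, 0 <= p x) -> bounded_measurable f ->
  (forall i, 0 <= f i) -> 0 <= law_mean p t f.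
Proof. by move=> p0 mf f0; apply: iid_mean_ge0 => // s; exact: state_mean_ge0. Qed.

Lemma law_mean_private p q (eps tau : R) t f :
  pan_private eps A -> 0 <= eps ->
  is_distribution p -> is_distribution q -> \sum_x `|p x - q x| <= tau ->
  bounded_measurable f -> (forall i, 0 <= f i) ->
  law_mean p t f <= expR (t%:R * (tau * (expR eps - 1))) * law_mean q t f.
Proof.
move=> priv e0 [p0 p1] [q0 q1] pq mf f0.
have tau0 : 0 <= tau by apply: le_trans pq; apply: sumr_ge0.
have E0 : 0 <= expR eps - 1 by rewrite subr_ge0 -expR0 ler_expR.
apply: (@le_trans _ _ ((1 + tau * (expR eps - 1)) ^+ t * law_mean q t f)).
  apply: iid_mean_private => // [s|s s' ss]; first exact: state_mean_ge0.
  exact: pan_private_mean.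
rewrite ler_wpM2r ?law_mean_ge0// le_expR_mulrn// addr_ge0// mulr_ge0//.
Qed.

End LawMean.

(** * The mixture: evolution of the state under privacy, second moment on raw samples *)

Section Mixture.
Context (R : realType) (k r : nat) (blk : 'I_k -> 'I_r) (a : 'I_k -> 'I_6 -> R).
Context (D : block_design blk a) (delta : R) (k0 : (0 < k)%N).
Hypotheses (d0 : 0 <= delta) (d1 : delta <= 1).
Context (dI : measure_display) (I : measurableType dI).
Context (dO : measure_display) (O : measurableType dO).
Variable A : stream_algorithm R k I O.
Implicit Types (f g : I -> R) (th : {ffun 'I_r -> 'I_6}).

Local Notation pth := (pert_dist blk a delta).
Local Notation U := (@uniform_dist R k).

Let pth_dist th : is_distribution (pth th). Proof. exact: pert_dist_distribution. Qed.
Let pth0 th x : 0 <= pth th x. Proof. by case: (pth_dist th). Qed.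
Let U0 x : 0 <= U x. Proof. by rewrite invr_ge0. Qed.
Let U1 : \sum_x U x = 1. Proof. exact: sum_uniform. Qed.

Definition mixture (t : nat) f : R := fin_mean (fun th => law_mean A (pth th) t f).

Lemma mixture_ge0 t f : bounded_measurable f -> (forall i, 0 <= f i) ->
  0 <= mixture t f.
Proof.
move=> mf f0; rewrite mulr_ge0 ?invr_ge0//; apply: sumr_ge0 => th _.
exact: law_mean_ge0.
Qed.

Lemma mixtureD t f g : bounded_measurable f -> bounded_measurable g ->
  mixture t (fun i => f i + g i) = mixture t f + mixture t g.
Proof. by move=> mf mg; rewrite -fin_meanD; apply: eq_fin_mean => th; exact: law_meanD. Qed.

Lemma mixtureZ t (c : R) f : bounded_measurable f ->
  mixture t (fun i => c * f i) = c * mixture t f.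
Proof. by move=> mf; rewrite -fin_meanZ; apply: eq_fin_mean => th; exact: law_meanZ. Qed.

Lemma mixture_sum t (J : Type) (s : seq J) (f : J -> I -> R) :
  (forall j, bounded_measurable (f j)) ->
  mixture t (fun i => \sum_(j <- s) f j i) = \sum_(j <- s) mixture t (f j).
Proof.
by move=> mf; rewrite -fin_mean_sum; apply: eq_fin_mean => th; exact: law_mean_sum.
Qed.

Section Privacy.
Variable eps : R.
Hypotheses (e0 : 0 <= eps) (priv : pan_private eps A).

Let E0 : 0 <= expR eps - 1. Proof. by rewrite subr_ge0 -expR0 ler_expR. Qed.

(* Bounds the posterior mean of every perturbation given the state at time [t]. *)
Definition leak (t : nat) : R :=
  4 * delta * (t%:R * (9 * delta / k%:R * (expR eps - 1))).

Let leak_ge0 t : 0 <= leak t.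
Proof. by rewrite !mulr_ge0 ?invr_ge0. Qed.

Lemma pert_mixture_le x t f : bounded_measurable f ->
  fin_mean (fun th => pert blk a delta th x * law_mean A (pth th) t f)
    <= leak t * mixture t (fun i => `|f i|).
Proof.
move=> mf.
pose nu h := fin_mean (fun th => pert blk a delta th x * law_mean A (pth th) t h).
rewrite -/(nu f).
have nu_le h : bounded_measurable h -> (forall i, 0 <= h i) ->
    `|nu h| <= leak t * mixture t h.
  move=> mh h0; apply: (pert_correlation_le D d0) => [th|th v].
    exact: law_mean_ge0.
  by apply: law_mean_private => //; exact: (sum_pert_dist_shift D).
(* The correlation bound [nu_le] needs nonnegative functions, so [f] is split into its positive and
   negative parts. *)
pose hp i := 2^-1 * (`|f i| + f i); pose hm i := 2^-1 * (`|f i| - f i).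
have mp : bounded_measurable hp.
  exact/bounded_measurableZ/bounded_measurableD/mf/bounded_measurable_norm.
have mm : bounded_measurable hm.
  exact/bounded_measurableZ/bounded_measurableB/mf/bounded_measurable_norm.
have hp0 i : 0 <= hp i by have := ler_norm (- f i); rewrite normrN /hp; lra.
have hm0 i : 0 <= hm i by have := ler_norm (f i); rewrite /hm; lra.
have -> : nu f = nu hp + -1 * nu hm.
  rewrite -fin_meanZ -fin_meanD; apply: eq_fin_mean => th.
  have -> : f = fun i => hp i - hm i by apply/funext => i; rewrite /hp /hm; field.
  by rewrite law_meanB//; ring.
have -> : (fun i => `|f i|) = fun i => hp i + hm i.
  by apply/funext => i; rewrite /hp /hm; field.
rewrite mixtureD// mulrDr.
have := nu_le _ mp hp0; have := nu_le _ mm hm0.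
rewrite !ler_norml => /andP[? ?] /andP[? ?]; lra.
Qed.

(** The next letter is uniform up to the weight [1 + pert]. Perturbations sum to zero over the
    letters, so [g] can be subtracted in the correction term, and [leak t] multiplies only
    deviations from the mean over letters. *)
Lemma mixture_step t f (g := fun i => uniform_mean (fun x => step A x f i)) :
  bounded_measurable f ->
  mixture t.+1 f <=
  mixture t (fun i => g i + leak t * uniform_mean (fun x => `|step A x f i - g i|)).
Proof.
move=> mf.
have ms x : bounded_measurable (step A x f) by exact: bounded_measurable_step.
have mg : bounded_measurable g.
  exact/bounded_measurableZ/bounded_measurable_sum.
have md x : bounded_measurable (fun i => step A x f i - g i).
  exact: bounded_measurableB.
have mn x := bounded_measurable_norm (md x).
rewrite mixtureD//; last first.
  exact/bounded_measurableZ/bounded_measurableZ/bounded_measurable_sum.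
rewrite mixtureZ; last exact/bounded_measurableZ/bounded_measurable_sum.
have -> : mixture t (fun i => uniform_mean (fun x => `|step A x f i - g i|)) =
    k%:R^-1 * \sum_x mixture t (fun i => `|step A x f i - g i|).
  by rewrite mixtureZ ?mixture_sum//; exact: bounded_measurable_sum.
rewrite [leak t * _]mulrCA [leak t * _]mulr_sumr.
have -> : mixture t.+1 f = mixture t g + k%:R^-1 * \sum_x
    fin_mean (fun th => pert blk a delta th x *
      law_mean A (pth th) t (fun i => step A x f i - g i)).
  rewrite -fin_mean_sum -fin_meanZ -fin_meanD; apply: eq_fin_mean => th.
  have gE : law_mean A (pth th) t g =
      k%:R^-1 * \sum_x law_mean A (pth th) t (step A x f).
    by rewrite law_meanZ ?law_mean_sum//; exact: bounded_measurable_sum.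
  have -> : \sum_x pert blk a delta th x *
        law_mean A (pth th) t (fun i => step A x f i - g i) =
      \sum_x pert blk a delta th x * law_mean A (pth th) t (step A x f).
    under eq_bigr => x _ do rewrite law_meanB// mulrBr.
    by rewrite sumrB -mulr_suml (sum_pert D) mul0r subr0.
  rewrite law_meanS gE -mulrDr -big_split mulr_sumr; apply: eq_bigr => x _ /=.
  by rewrite /pert_dist /uniform_dist; ring.
rewrite lerD2l ler_wpM2l ?invr_ge0//; apply: ler_sum => x _.
exact: pert_mixture_le.
Qed.

(* In dual form: the chi-square divergence of the mixture from the null law of
   the state at time [t] is at most [expR (\sum_(j < t) leak j ^+ 2) - 1]. *)
Lemma mixture_sqr_le t f : bounded_measurable f -> (forall i, 0 <= f i) ->
  mixture t f ^+ 2 <=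
  expR (\sum_(j < t) leak j ^+ 2) * law_mean A U t (fun i => f i ^+ 2).
Proof.
elim: t f => [|t IH] f mf f0.
  (* At time 0 the mixture is the initial law, and the claim is Jensen's inequality. *)
  rewrite big_ord0 expR0 mul1r /mixture (fin_mean_cst _ [ffun=> 0]).
  exact/sqr_mean_le/mf/probability_setT.
pose g i := uniform_mean (fun x => step A x f i).
pose F i := g i + leak t * uniform_mean (fun x => `|step A x f i - g i|).
have ms x : bounded_measurable (step A x f) by exact: bounded_measurable_step.
have mg : bounded_measurable g.
  exact/bounded_measurableZ/bounded_measurable_sum.
have mF : bounded_measurable F.
  apply/bounded_measurableD/bounded_measurableZ/bounded_measurableZ => //.
  apply: bounded_measurable_sum => x; apply: bounded_measurable_norm.
  exact: bounded_measurableB.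
have F0 i : 0 <= F i.
  rewrite addr_ge0// ?mulr_ge0 ?invr_ge0//; last exact: sumr_ge0.
  by apply: sumr_ge0 => x _; exact: Rintegral_ge0.
apply: (@le_trans _ _ (mixture t F ^+ 2)).
  by rewrite lerXn2r ?nnegrE ?mixture_ge0//; exact: mixture_step.
apply: (le_trans (IH _ mF F0)); rewrite big_ord_recr /= expRD -mulrA.
rewrite ler_wpM2l ?expR_ge0//.
have mf2 : bounded_measurable (fun i => f i ^+ 2) by exact: bounded_measurableX.
have ms2 x : bounded_measurable (step A x (fun i => f i ^+ 2)).
  exact: bounded_measurable_step.
apply: (@le_trans _ _ (law_mean A U t (fun i => (1 + leak t ^+ 2) *
   (k%:R^-1 * \sum_x step A x (fun j => f j ^+ 2) i)))).
  apply: le_law_mean => //; first exact: bounded_measurableX.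
    exact/bounded_measurableZ/bounded_measurableZ/bounded_measurable_sum.
  (* Pointwise in the state, orthogonality makes the leak enter squared; Jensen's inequality for
     each letter then moves the square inside [step]. *)
  move=> i; apply: (le_trans (sqr_mean_add_dev_le _ _ k0)).
  rewrite ler_wpM2l ?addr_ge0 ?sqr_ge0//; apply: le_uniform_mean => x.
  exact: sqr_step_le.
rewrite law_meanZ; last exact/bounded_measurableZ/bounded_measurable_sum.
rewrite law_meanZ; last exact: bounded_measurable_sum.
rewrite law_mean_sum// mulr_sumr law_meanS ler_wpM2r ?expR_ge1Dx//.
apply: sumr_ge0 => x _; rewrite mulr_ge0// law_mean_ge0// => i.
by apply: Rintegral_ge0 => j _; exact: sqr_ge0.
Qed.

End Privacy.

(** The second-moment method, with [S s] the probability of rejecting on the sample [s]. Separating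
    null from mixture forces the likelihood ratio [L] to have second moment at least 4/3, while
    [fin_mean_inner_le] bounds that moment from above. *)
Lemma ingster (m : nat) (S : seq 'I_k -> R) :
  (forall s, 0 <= S s <= 1) -> iid_mean U m S <= 1 / 3 ->
  (forall th, 2 / 3 <= iid_mean (pth th) m S) ->
  1 / 4 <= r%:R * (3 * (12 * (m%:R * delta ^+ 2 / k%:R)) ^+ 2).
Proof.
move=> S01 Unull alt.
pose w th (s : seq 'I_k) := \prod_(x <- s) (1 + pert blk a delta th x).
pose L s := fin_mean (fun th => w th s).
have LS : 2 / 3 <= iid_mean U m (fun s => L s * S s).
  have -> : iid_mean U m (fun s => L s * S s) = fin_mean (fun th => iid_mean (pth th) m S).
    transitivity (fin_mean (fun th => iid_mean U m (fun s => w th s * S s))).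
      rewrite -iid_mean_fin_mean; apply: eq_iid_mean => s.
      by rewrite /L /fin_mean -mulrA mulr_suml.
    by apply: eq_fin_mean => th; rewrite [RHS]iid_mean_reweight.
  rewrite -[leLHS](fin_mean_cst (2 / 3) ([ffun=> 0] : {ffun 'I_r -> 'I_6})).
  exact: le_fin_mean.
have L2 : iid_mean U m (fun s => L s ^+ 2) <=
    expR (r%:R * (3 * (12 * (m%:R * delta ^+ 2 / k%:R)) ^+ 2)).
  (* The square of an average over [th] is an average over two independent copies, and each product
     of likelihood ratios factors over the samples. *)
  have -> : iid_mean U m (fun s => L s ^+ 2) = fin_mean (fun th' => fin_mean (fun th =>
      (\sum_x U x * ((1 + pert blk a delta th x) * (1 + pert blk a delta th' x))) ^+ m)).
    transitivity (fin_mean (fun th' => fin_mean (fun th =>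
      iid_mean U m (fun s => w th s * w th' s)))).
      transitivity (fin_mean (fun th' => iid_mean U m (fun s => L s * w th' s))).
        rewrite -iid_mean_fin_mean; apply: eq_iid_mean => s.
        by rewrite fin_meanZ expr2.
      apply: eq_fin_mean => th'; rewrite -iid_mean_fin_mean; apply: eq_iid_mean => s.
      by rewrite /L /fin_mean -mulrA mulr_suml.
    apply: eq_fin_mean => th'; apply: eq_fin_mean => th; rewrite -iid_mean_prod.
    by apply: eq_iid_mean => s; rewrite -big_split.
  rewrite -[leRHS](fin_mean_cst _ ([ffun=> 0] : {ffun 'I_r -> 'I_6})).
  by apply: le_fin_mean => th'; exact: (fin_mean_inner_le D).
(* [L] is the likelihood ratio of the mixture; expand [(L - 2 S)^2 >= 0]. *)
have : 4 / 3 <= iid_mean U m (fun s => L s ^+ 2).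
  have -> : 4 / 3 = 4 * (2 / 3) + -4 * (1 / 3) :> R by field.
  apply: (@le_trans _ _ (4 * iid_mean U m (fun s => L s * S s) + -4 * iid_mean U m S)).
    lra.
  rewrite -!iid_meanZ -iid_meanD; apply: le_iid_mean => // s _.
  have /andP[] := S01 s; have := sqr_ge0 (L s - 2 * S s); nra.
move=> h; have := expR_lower _ (le_trans h L2); lra.
Qed.

End Mixture.

(** * The three lower bounds *)

Section Output.
Context (R : realType) (k : nat) (dI : measure_display) (I : measurableType dI).
Variable A : stream_algorithm R k I bool.

Definition answer_prob (b : bool) (i : I) : R := fine (output A i [set b]).

Lemma EFin_answer_prob b i : (answer_prob b i)%:E = output A i [set b].
Proof.
rewrite fineK// ge0_fin_numE//; apply: (@le_lt_trans _ _ (output A i setT)).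
  by apply: le_measure; rewrite ?inE.
by rewrite prob_kernel ltry.
Qed.

Lemma answer_prob_ge0 b i : 0 <= answer_prob b i.
Proof. by rewrite -lee_fin EFin_answer_prob. Qed.

Lemma answer_prob_le1 b i : answer_prob b i <= 1.
Proof.
rewrite -lee_fin EFin_answer_prob -(@prob_kernel _ _ _ _ _ (output A) i).
by apply: le_measure; rewrite ?inE.
Qed.

Lemma answer_probC i : answer_prob true i + answer_prob false i = 1.
Proof.
apply: EFin_inj; rewrite EFinD !EFin_answer_prob -measureU//.
  rewrite -(@prob_kernel _ _ _ _ _ (output A) i); congr (output A i _).
  by apply/seteqP; split => // -[] _; [left|right].
by apply/seteqP; split => // -[] [].
Qed.

Lemma bounded_measurable_answer b : bounded_measurable (answer_prob b).
Proof.
split; last by exists 1 => i; rewrite ger0_norm ?answer_prob_ge0 ?answer_prob_le1.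
apply/measurable_EFinP; rewrite /comp.
by under eq_fun do rewrite EFin_answer_prob; exact: measurable_kernel.
Qed.

Lemma iid_output_probE (p : 'I_k -> R) m b :
  iid_output_prob A p m b = (law_mean A p m (answer_prob b))%:E.
Proof.
rewrite /law_mean iid_mean_tuple -sumEFin; apply: eq_bigr => s _.
rewrite EFinM; congr (_ * _)%E.
rewrite -integral_expect_from; last exact: bounded_measurable_answer.
apply: eq_integral => i _; congr (expect_from A _ _ i); apply/funext => j /=.
by rewrite EFin_answer_prob.
Qed.

End Output.

Section Bounds.
Context (R : realType) (k : nat) (eps alpha : R) (m : nat).
Context (dI : measure_display) (I : measurableType dI).
Variable A : stream_algorithm R k I bool.
Hypotheses (k2 : (2 <= k)%N) (e0 : 0 < eps) (a0 : 0 < alpha) (a1 : alpha <= 1 / 2).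
Hypotheses (priv : pan_private eps A) (test : uniformity_tester m alpha A).

(** The three constraints give, in order, the terms in [1 / (alpha * eps)], [k^{2/3}] and
    [sqrt k]. *)
Lemma tester_bounds :
  [/\ 1 / 2 <= m%:R * (4 * alpha * (expR eps - 1)),
      1 / 4 <= \sum_(j < m) (144 * alpha ^+ 2 * j%:R * (expR eps - 1) / k%:R) ^+ 2
    & 1 / 4 <= 3 * (48 * (m%:R * alpha ^+ 2)) ^+ 2 / k%:R ].
Proof.
have [r [blk [a [rk D]]]] := block_design_exists R k2.
have k0 : (0 < k)%N by lia.
have kR : 0 < k%:R :> R by rewrite ltr0n.
(* The perturbed distributions are at distance at least [delta / 2] from uniform; [alpha <= 1 / 2]
   keeps them nonnegative. *)
pose delta := 2 * alpha.
have d0 : 0 <= delta by rewrite /delta; move: a0; lra.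
have d1 : delta <= 1 by rewrite /delta; move: a1; lra.
pose f := answer_prob A false.
have mf : bounded_measurable f by exact: bounded_measurable_answer.
have f0 i : 0 <= f i by exact: answer_prob_ge0.
have f1 i : f i <= 1 by exact: answer_prob_le1.
have Udist : is_distribution (@uniform_dist R k).
  by split=> [x|]; [rewrite invr_ge0 | exact: sum_uniform].
have [tU tP] := test.
have null : law_mean A (@uniform_dist R k) m f <= 1 / 3.
  move: tU; rewrite iid_output_probE lee_fin.
  have -> : answer_prob A true = fun i => 1 - f i.
    by apply/funext => i; rewrite /f -(answer_probC A i) addrK.
  rewrite law_meanB//; last exact: bounded_measurable_cst.
  have -> : law_mean A (@uniform_dist R k) m (fun=> 1) = 1.
    case: Udist => _ U1; rewrite -[RHS](iid_mean_cst m 1 U1); apply: eq_iid_mean => s.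
    exact: state_mean_cst.
  lra.
have alt th : 2 / 3 <= law_mean A (pert_dist blk a delta th) m f.
  rewrite -lee_fin -iid_output_probE; apply: tP.
    exact: pert_dist_distribution.
  apply: le_trans (dTV_pert_dist D k0 d0 th).
  by rewrite /delta mulrAC divff// mul1r.
split.
- pose th : {ffun 'I_r -> 'I_6} := [ffun=> 0].
  have := law_mean_private m priv (ltW e0) (pert_dist_distribution D k0 d0 d1 th)
    Udist (sum_pert_dist_diff D k0 d0 th) mf f0.
  have := alt th; move: null.
  set q := law_mean _ _ _ _; set p := law_mean _ _ _ _; set E := expR _ => qn pa pq.
  (* The probability of rejecting must grow from at most 1/3 to at least 2/3. *)
  have E2 : 2 <= E.
    have E0 : 0 < E by exact: expR_gt0.
    have : E * q <= E * (1 / 3) by rewrite ler_wpM2l// ltW.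
    lra.
  have := expR_lower _ E2; rewrite /delta.
  have -> : m%:R * (2 * (2 * alpha) * (expR eps - 1))
    = m%:R * (4 * alpha * (expR eps - 1)) by ring.
  lra.
- have := mixture_sqr_le D k0 d0 d1 (ltW e0) priv m mf f0.
  have P23 : 2 / 3 <= mixture blk a delta A m f.
    rewrite -[leLHS](fin_mean_cst (2 / 3) ([ffun=> 0] : {ffun 'I_r -> 'I_6})).
    exact: le_fin_mean.
  have f2 : law_mean A (@uniform_dist R k) m (fun i => f i ^+ 2) <= 1 / 3.
    apply: le_trans null; apply: le_law_mean => //.
    - by case: Udist.
    - exact: bounded_measurableX.
    - by move=> i; have := f0 i; have := f1 i; nra.
  have -> : \sum_(j < m) leak k delta eps j ^+ 2 =
    \sum_(j < m) (144 * alpha ^+ 2 * j%:R * (expR eps - 1) / k%:R) ^+ 2.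
    by apply: eq_bigr => j _; congr (_ ^+ 2); rewrite /leak /delta; ring.
  move: P23 f2.
  set q := law_mean _ _ _ _; set p := mixture _ _ _ _ _ _; set E := expR _ => pa qn pq.
  (* Here the mixture probability enters squared: [(2 / 3) ^+ 2] against 1/3. *)
  have E43 : 4 / 3 <= E.
    have E0 : 0 < E by exact: expR_gt0.
    have : E * q <= E * (1 / 3) by rewrite ler_wpM2l// ltW.
    have : (2 / 3) * (2 / 3) <= p ^+ 2 by rewrite expr2 ler_pM; lra.
    lra.
  have := expR_lower _ E43; lra.
- have := ingster D k0 d0 d1 (m := m) (S := fun s => state_mean A s f).
  move=> /(_ _ null alt) h.
  apply: le_trans (h _) _ => [s|].
    apply/andP; split; first exact: state_mean_ge0.
    rewrite -[leRHS](state_mean_cst A s 1); apply: le_state_mean => //.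
    exact: bounded_measurable_cst.
  have -> : r%:R * (3 * (12 * (m%:R * delta ^+ 2 / k%:R)) ^+ 2) =
    (3 * (48 * (m%:R * alpha ^+ 2)) ^+ 2 / k%:R) * (r%:R / k%:R).
    by rewrite /delta; field; rewrite gt_eqF.
  apply: ler_piMr; first by rewrite divr_ge0 ?mulr_ge0 ?sqr_ge0// ltW.
  by rewrite ler_pdivrMr// mul1r ler_nat.
Qed.

End Bounds.

(** * From the three constraints to the sample bound *)

Lemma powR23_cube (R : realType) (x : R) : 0 <= x -> (x `^ (2 / 3)) ^+ 3 = x ^+ 2.
Proof.
move=> x0; rewrite -powR_mulrn ?powR_ge0// -powRrM -powR_mulrn//.
by congr (_ `^ _); field.
Qed.

Lemma powR43_cube (R : realType) (x : R) : 0 <= x -> (x `^ (4 / 3)) ^+ 3 = x ^+ 4.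
Proof.
move=> x0; rewrite -powR_mulrn ?powR_ge0// -powRrM -powR_mulrn//.
by congr (_ `^ _); field.
Qed.

Theorem theorem3 (R : realType) (eps0 : R) (heps0 : 0 < eps0) :
  exists c : R, 0 < c /\
    forall (k : nat) (eps alpha : R),
      (2 <= k)%N ->
      0 < eps -> eps <= eps0 ->
      0 < alpha -> alpha <= 1 / 2 ->
      forall (dI : measure_display) (I : measurableType dI)
             (A : stream_algorithm R k I bool) (m : nat),
        pan_private eps A ->
        uniformity_tester m alpha A ->
        c * (k%:R `^ (2 / 3) / (alpha `^ (4 / 3) * eps `^ (2 / 3))
             + Num.sqrt k%:R / alpha ^+ 2
             + 1 / (alpha * eps))
        <= m%:R.
Proof.
(* [C] linearizes the privacy loss: [expR eps - 1 <= eps * C] whenever [eps <= eps0]. *)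
pose C := expR eps0.
have C1 : 1 <= C by rewrite -expR0 ler_expR ltW.
have C0 : 0 < C by lra.
(* 344 is 8 + 192 + 144, from [T3], [T2] and [T1]. *)
exists (344 * C)^-1; split; first by rewrite invr_gt0 mulr_gt0 ?ltr0n.
move=> k eps alpha k2 e0 ee a0 a1 dI I A m priv test.
have kR : 0 < k%:R :> R by rewrite ltr0n; lia.
have [B1 B2 B3] := tester_bounds k2 e0 a0 a1 priv test.
have E0 : 0 <= expR eps - 1 by rewrite subr_ge0 -expR0 ler_expR ltW.
have EC : expR eps - 1 <= eps * C.
  apply: (le_trans (expR_sub1_le _)); rewrite ler_pM2l// ler_expR//.
have m0 : 0 <= m%:R :> R by [].
have T3 : 1 / (alpha * eps) <= 8 * C * m%:R.
  rewrite ler_pdivrMr ?mulr_gt0//.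
  have : m%:R * (4 * alpha * (expR eps - 1)) <= m%:R * (4 * alpha * (eps * C)).
    by rewrite ler_wpM2l// ler_wpM2l// mulr_ge0// ltW.
  lra.
have T2 : Num.sqrt k%:R / alpha ^+ 2 <= 192 * m%:R.
  rewrite ler_pdivrMr ?exprn_gt0//; move: B3.
  rewrite ler_pdivlMr//; set y := m%:R * alpha ^+ 2 => B3.
  have y0 : 0 <= y by rewrite mulr_ge0 ?sqr_ge0.
  have -> : 192 * m%:R * alpha ^+ 2 = 192 * y by rewrite /y mulrA.
  rewrite -[leRHS]ger0_norm; last by rewrite mulr_ge0 ?ler0n.
  rewrite -sqrtr_sqr.
  (* [B3] says that [k] is at most 12 times the square of [48 * y], and 192 = 4 * 48 rounds the
     square root of 12 up to 4. *)
  by apply: ler_wsqrtr; rewrite !expr2 in B3 *; nra.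
have T1 : k%:R `^ (2 / 3) / (alpha `^ (4 / 3) * eps `^ (2 / 3)) <= 144 * C * m%:R.
  have l0 : 0 <= k%:R `^ (2 / 3) / (alpha `^ (4 / 3) * eps `^ (2 / 3)).
    by rewrite divr_ge0 ?mulr_ge0 ?powR_ge0.
  have r0 : 0 <= 144 * C * m%:R by rewrite !mulr_ge0 ?ler0n ?(ltW C0).
  (* Cubing removes the fractional powers. *)
  rewrite -(@ler_pXn2r _ 3) ?nnegrE//.
  have -> : (k%:R `^ (2 / 3) / (alpha `^ (4 / 3) * eps `^ (2 / 3))) ^+ 3 =
      k%:R ^+ 2 / (alpha ^+ 4 * eps ^+ 2).
    by rewrite expr_div_n exprMn powR43_cube ?powR23_cube// ltW.
  rewrite ler_pdivrMr ?mulr_gt0 ?exprn_gt0//.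
  (* Bounding [j] by [m] in every term turns the sum of squares into a multiple of [m%:R ^+ 3]. *)
  have : \sum_(j < m) (144 * alpha ^+ 2 * j%:R * (expR eps - 1) / k%:R) ^+ 2
      <= \sum_(j < m) (144 * alpha ^+ 2 * m%:R * (eps * C) / k%:R) ^+ 2.
    have c0 : 0 <= 144 * alpha ^+ 2 by rewrite mulr_ge0 ?ler0n ?sqr_ge0.
    apply: ler_sum => j _.
    have j0 : 0 <= 144 * alpha ^+ 2 * j%:R * (expR eps - 1) / k%:R.
      exact/divr_ge0/ltW/kR/mulr_ge0/E0/mulr_ge0/ler0n.
    have le : 144 * alpha ^+ 2 * j%:R * (expR eps - 1) / k%:R
        <= 144 * alpha ^+ 2 * m%:R * (eps * C) / k%:R.
      rewrite ler_wpM2r ?invr_ge0 ?(ltW kR)//; apply: ler_pM => //.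
        exact/mulr_ge0/ler0n.
      by apply: ler_wpM2l => //; rewrite ler_nat ltnW.
    by apply: lerXn2r => //; rewrite nnegrE (le_trans j0).
  rewrite sumr_const card_ord -[leRHS]mulr_natl => S.
  have := le_trans B2 S.
  have : 4 <= 144 :> R by rewrite ler_nat.
  (* From here on only [4 <= K] matters: it absorbs the 1/4 of [B2] into one more factor [K * C]. *)
  move: (144 : R) => K K4.
  have -> : m%:R * (K * alpha ^+ 2 * m%:R * (eps * C) / k%:R) ^+ 2 =
    K ^+ 2 * C ^+ 2 * (m%:R ^+ 3 * (alpha ^+ 4 * eps ^+ 2)) / k%:R ^+ 2.
    by field; rewrite gt_eqF.
  rewrite ler_pdivlMr ?exprn_gt0// => h.
  set Y := m%:R ^+ 3 * (alpha ^+ 4 * eps ^+ 2) in h.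
  have Y0 : 0 <= Y by rewrite !mulr_ge0 ?exprn_ge0 ?(ltW a0) ?(ltW e0).
  have -> : (K * C * m%:R) ^+ 3 * (alpha ^+ 4 * eps ^+ 2) =
      (K * C) * (K ^+ 2 * C ^+ 2 * Y) by rewrite /Y; ring.
  have h4 : 4 <= K * C by nra.
  have : 4 * (K ^+ 2 * C ^+ 2 * Y) <= (K * C) * (K ^+ 2 * C ^+ 2 * Y).
    apply: ler_wpM2r => //.
    exact: mulr_ge0 (mulr_ge0 (sqr_ge0 _) (sqr_ge0 _)) Y0.
  lra.
rewrite ler_pdivrMl; last by rewrite mulr_gt0 ?ltr0n.
have : 192 * m%:R <= 192 * C * m%:R by rewrite ler_wpM2r//; lra.
lra.
Qed.
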